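(* Let $n\ge 1$ and let $SReg(\mathcal{ORCP}_n)$ be the set of all strongly regular elements of $\mathcal{ORCP}_n$. Then $SReg(\mathcal{ORCP}_n)$ is a regular subsemigroup of $\mathcal{ORCP}_n$ (that is, it is closed under composition, and it is a regular semigroup).
   Context: Let $[n]=\{1,2,\dots,n\}$ with the usual order, and let $\mathcal{P}_n$ be the semigroup of all partial maps $\alpha$ with domain $\operatorname{Dom}\alpha\subseteq[n]$ and image contained in $[n]$ (including the empty map). Maps are written on the right and composed left to right: $x(\alpha\beta)=(x\alpha)\beta$, defined for those $x\in\operatorname{Dom}\alpha$ with $x\alpha\in\operatorname{Dom}\beta$. A map $\alpha\in\mathcal{P}_n$ is a contraction if $|x\alpha-y\alpha|\le|x-y|$ for all $x,y\in\operatorname{Dom}\alpha$; it is order preserving (resp. order reversing) if for all $x,y\in\operatorname{Dom}\alpha$, $x\le y$ implies $x\alpha\le y\alpha$ (resp. $x\alpha\ge y\alpha$). $\mathcal{ORCP}_n$ is the semigroup of all contractions in $\mathcal{P}_n$ that are order preserving or order reversing. An element $a$ of a semigroup $S$ is regular if $a=aba$ for some $b\in S$; $S$ is regular if all its elements are regular in $S$. For $\alpha\in\mathcal{P}_n$, $\mathbf{Ker}\,\alpha=\{A_1,\dots,A_p\}$ is the partition of $\operatorname{Dom}\alpha$ into the nonempty fibres of $\alpha$. A transversal of $\mathbf{Ker}\,\alpha$ is a subset $T\subseteq\operatorname{Dom}\alpha$ with $|A_i\cap T|=1$ for all $1\le i\le p$. A subset $T\subseteq[n]$ is convex if $x,y\in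 T$, $z\in[n]$ and $x\le z\le y$ imply $z\in T$. An element $\alpha\in\mathcal{ORCP}_n$ is strongly regular if it is a regular element of $\mathcal{ORCP}_n$ and $\mathbf{Ker}\,\alpha$ has a convex transversal. *)

(* Defs.v *)
From HB Require Import structures.
From mathcomp Require Import all_boot all_order all_algebra.

Set Implicit Arguments.
Unset Strict Implicit.
Unset Printing Implicit Defensive.

(* The chain {1, ..., n} is represented by 'I_n, i.e. shifted to             *)
(* {0, ..., n-1}; only the order and the distances |x - y| matter below.     *)
(* A partial map sends x to None exactly when x is outside its domain.       *)
Definition pmap_on (n : nat) : Type := {ffun 'I_n -> option 'I_n}.

HB.instance Definition _ n :=
  Finite.on (pmap_on n).

(* Maps are written on the right: x (a b) = (x a) b. *)
Definition pcompose n (a b : pmap_on n) : pmap_on n :=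
  [ffun x => obind (fun y => (b : {ffun _ -> _}) y)
                   ((a : {ffun _ -> _}) x)].

Lemma pcomposeA n : associative (@pcompose n).
Proof.
move=> a b c; apply/ffunP => x; rewrite !ffunE.
by case: ((a : {ffun _ -> _}) x) => [y|] //=; rewrite ffunE.
Qed.

HB.instance Definition _ n := isSemigroup.Build (pmap_on n) (@pcomposeA n).

Section PartialMaps.
Variable n : nat.
Implicit Types (a b : pmap_on n) (A B : {set pmap_on n}) (T : {set 'I_n}).

Definition papp a (x : 'I_n) : option 'I_n := (a : {ffun _ -> _}) x.

Definition Dom a : {set 'I_n} := [set x | papp a x != None].

Definition contraction a : bool :=
  [forall x, forall y, forall u, forall v,
    (papp a x == Some u) ==> (papp a y == Some v) ==>
    (`|(u : nat)%:Z - (v : nat)%:Z| <= `|(x : nat)%:Z - (y : nat)%:Z|)%R].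

Definition order_preserving a : bool :=
  [forall x, forall y, forall u, forall v,
    (papp a x == Some u) ==> (papp a y == Some v) ==> (x <= y) ==> (u <= v)].

Definition order_reversing a : bool :=
  [forall x, forall y, forall u, forall v,
    (papp a x == Some u) ==> (papp a y == Some v) ==> (x <= y) ==> (u >= v)].

Definition ORCP : {set pmap_on n} :=
  [set a | contraction a & order_preserving a || order_reversing a].

Definition regular_in A a : bool :=
  (a \in A) && [exists b in A, a == (a * b * a)%g].

Definition subsemigroup A B : Prop := A \subset B /\ mulg_closed A.

Definition regular_semigroup A : Prop :=
  mulg_closed A /\ {in A, forall a, regular_in A a}.

(* The partition of Dom a into the nonempty fibres of a. *)
Definition Ker a : {set {set 'I_n}} := preim_partition (papp a) (Dom a).

Definition convex T : bool :=
  [forall x in T, forall y in T, forall z : 'I_n, (x <= z <= y) ==> (z \in T)].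

Definition SReg : {set pmap_on n} :=
  [set a | regular_in ORCP a &
           [exists T, is_transversal T (Ker a) (Dom a) && convex T]].

End PartialMaps.

Arguments ORCP n : clear implicits.
Arguments SReg n : clear implicits.

Section Closure.
Variable n : nat.
Implicit Types a b : pmap_on n.

Lemma papp_mul a b x w : papp (a * b)%g x = Some w ->
  exists2 u, papp a x = Some u & papp b u = Some w.
Proof.
rewrite /papp ffunE; case E: ((a : {ffun _ -> _}) x) => [u|] //= bu.
by exists u.
Qed.

Lemma pmap_rel4P a (R : 'I_n -> 'I_n -> 'I_n -> 'I_n -> bool) :
  reflect (forall x y u v, papp a x = Some u -> papp a y = Some v -> R x y u v)
    [forall x, forall y, forall u, forall v,
      (papp a x == Some u) ==> (papp a y == Some v) ==> R x y u v].
Proof.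
apply: (iffP idP) => [H x y u v /eqP xu /eqP yv|H].
  move/forallP/(_ x)/forallP/(_ y)/forallP/(_ u)/forallP/(_ v): H.
  by rewrite xu yv.
apply/forallP => x; apply/forallP => y; apply/forallP => u; apply/forallP => v.
by apply/implyP => /eqP xu; apply/implyP => /eqP yv; apply: H.
Qed.

Lemma ORCP_mulg_closed : mulg_closed (ORCP n).
Proof.
move=> a b; rewrite !inE => /andP[/pmap_rel4P ca oa] /andP[/pmap_rel4P cb ob].
apply/andP; split.
  apply/pmap_rel4P => x y u v /papp_mul[x' xx' x'u] /papp_mul[y' yy' y'v].
  exact: Order.POrderTheory.le_trans (cb _ _ _ _ x'u y'v) (ca _ _ _ _ xx' yy').
case/orP: oa => /pmap_rel4P oa; case/orP: ob => /pmap_rel4P ob;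
  apply/orP; [left|right|right|left];
  apply/pmap_rel4P => x y u v /papp_mul[x' xx' x'u] /papp_mul[y' yy' y'v];
  apply/implyP => xy; move: (oa _ _ _ _ xx' yy'); rewrite xy /= => xy';
  first [by move: (ob _ _ _ _ x'u y'v); rewrite xy'
        |by move: (ob _ _ _ _ y'v x'u); rewrite xy'].
Qed.

End Closure.

(* Main.v *)
Require Import Defs.
From mathcomp Require Import all_boot.
From mathcomp Require Import zify.

Set Implicit Arguments.
Unset Strict Implicit.

(** On a convex transversal [T] of its kernel, a monotone contraction is
    injective, so consecutive points move by exactly one step: it restricts to an
    isometry of [T] onto its image, which is therefore convex.  The inverse of
    this restriction is again a strongly regular element, which gives regularity.
    For a product [a * b] with convex transversals [T1] and [T2], monotonicity
    forces [b] to be constant on each side of [T2]; hence the points of [T1] that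
    [a] sends into [T2] form a convex transversal, unless there are none, in
    which case [a * b] is constant on its domain. *)

(** * Pointwise forms of monotone contraction, convexity and transversal *)

Lemma ORCP_P (n : nat) (a : pmap_on n) :
  reflect
    ((forall x y u v, papp a x = Some u -> papp a y = Some v ->
       x <= y -> u <= v + (y - x) /\ v <= u + (y - x)) /\
     ((forall x y u v, papp a x = Some u -> papp a y = Some v ->
         x <= y -> u <= v) \/
      (forall x y u v, papp a x = Some u -> papp a y = Some v ->
         x <= y -> v <= u)))
    (a \in ORCP n).
Proof.
rewrite inE; apply: (iffP andP) => [[/pmap_rel4P ca oa]|[ca oa]]; split.
- by move=> x y u v xu yv xy; move: (ca _ _ _ _ xu yv); lia.
- case/orP: oa => /pmap_rel4P oa; [left|right] => x y u v xu yv xy;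
    by move: (oa _ _ _ _ xu yv); rewrite xy.
- apply/pmap_rel4P => x y u v xu yv.
  by have [/(ca _ _ _ _ xu yv)|/ltnW /(ca _ _ _ _ yv xu)] := leqP x y; lia.
- apply/orP; case: oa => oa; [left|right]; apply/pmap_rel4P => x y u v xu yv;
    by apply/implyP; apply: oa.
Qed.

(** Monotonicity without a direction, so that later arguments treat the preserving and reversing
    cases together. *)
Lemma ORCP_between (n : nat) (a : pmap_on n) (x y z u v w : 'I_n) :
    a \in ORCP n ->
    papp a x = Some u -> papp a y = Some v -> papp a z = Some w ->
    x <= y <= z ->
  (u <= v <= w) || (w <= v <= u).
Proof.
move=> /ORCP_P[_ oa] xu yv zw /andP[xy yz].
by case: oa => oa; rewrite (oa _ _ _ _ xu yv xy) (oa _ _ _ _ yv zw yz) ?orbT.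
Qed.

Lemma convexP (n : nat) (T : {set 'I_n}) :
  reflect (forall x y z : 'I_n, x \in T -> y \in T -> x <= z <= y -> z \in T)
          (convex T).
Proof.
apply: (iffP forall_inP) => [H x y z xT yT xzy|H x xT].
  by move/(_ x xT)/forall_inP/(_ y yT)/forallP/(_ z): H; rewrite xzy.
by apply/forall_inP => y yT; apply/forallP => z; apply/implyP; apply: H.
Qed.

(** A transversal of the kernel, described without blocks: the last two clauses give at most one and
    at least one point per fibre. *)
Definition kernel_section (n : nat) (a : pmap_on n) (T : {set 'I_n}) : Prop :=
  [/\ forall t, t \in T -> exists u, papp a t = Some u,
      forall s t, s \in T -> t \in T -> papp a s = papp a t -> s = t &
      forall x u, papp a x = Some u -> exists2 t, t \in T & papp a t = Some u].

Lemma DomP (n : nat) (a : pmap_on n) x :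
  reflect (exists u, papp a x = Some u) (x \in Dom a).
Proof.
rewrite inE; case: (papp a x) => [u|] /=; constructor; first by exists u.
by case.
Qed.

Lemma transversal_KerP (n : nat) (a : pmap_on n) (T : {set 'I_n}) :
  reflect (kernel_section a T) (is_transversal T (Ker a) (Dom a)).
Proof.
rewrite /is_transversal preim_partitionP /=.
apply: (iffP andP) => [[sTD /forall_inP trT]|[domT injT surjT]].
  have fibre x : x \in Dom a ->
      exists z, T :&: [set y in Dom a | papp a x == papp a y] = [set z].
    by move=> xD; apply/cards1P/trT/imsetP; exists x.
  split=> [t tT|s t sT tT st|x u xu].
  - by apply/DomP/(subsetP sTD).
  - have [sD tD] := (subsetP sTD s sT, subsetP sTD t tT).
    have [z /setP Tz] := fibre s sD.
    move: (Tz s) (Tz t); rewrite !in_setI ![_ \in [set _ in _ | _]]in_set.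
    rewrite sT tT sD tD st !eqxx.
    by rewrite !in_set1 => /esym/eqP -> /esym/eqP ->.
  - have /fibre[z /setP/(_ z)] : x \in Dom a by apply/DomP; exists u.
    by rewrite set11 in_setI in_set xu => /and3P[zT _ /eqP zu]; exists z.
split; first by apply/subsetP => t /domT/DomP.
apply/forall_inP => _ /imsetP[x /DomP[u xu] ->]; apply/cards1P.
have [t tT tu] := surjT x u xu; exists t; apply/setP => y.
rewrite in_setI in_set in_set1 xu; apply/and3P/eqP => [[yT _ /eqP uy]|->].
  by apply: injT => //; rewrite tu.
by split; rewrite ?tu //; apply/DomP; exists u.
Qed.

(** * Isometry on a convex transversal *)

Lemma section_isometry (n : nat) (a : pmap_on n) (T : {set 'I_n})
    (s t u v : 'I_n) :
    a \in ORCP n -> convex T -> kernel_section a T ->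
    s \in T -> t \in T -> papp a s = Some u -> papp a t = Some v -> s <= t ->
  u + (t - s) = v \/ v + (t - s) = u.
Proof.
move=> aO /convexP cT [domT injT _] sT tT su tv st.
have /ORCP_P[/(_ _ _ _ _ su tv st) [uv vu] _] := aO.
(* The contraction bounds supply the reverse inequalities. That distances do not shrink goes by
   induction on [t - s], through the predecessor [r] of [t]. *)
suff: u + (t - s) <= v \/ v + (t - s) <= u by lia.
have [d dE] : exists d, d = t - s by exists (t - s).
elim: d t v tT tv st dE {uv vu} => [|d IHd] t v tT tv st dE.
  have ts : t = s by apply: val_inj => /=; lia.
  by move: tv; rewrite ts su => -[<-]; lia.
have ltn : t.-1 < n by have := ltn_ord t; lia.
pose r := Ordinal ltn.
have rT : r \in T by apply: (cT s t) => //=; lia.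
have [w rw] := domT r rT.
have vw : w <> v :> nat.
  move/val_inj => wv; have : r = t by apply: injT => //; rewrite rw wv tv.
  by move/(congr1 val) => /=; lia.
(* [w] lies between [u] and [v] and differs from [v], so the last step adds at least one to the
   distance from [u]. *)
have := IHd r w rT rw; have := ORCP_between aO su rw tv.
rewrite /=; lia.
Qed.

Lemma section_image_convex (n : nat) (a : pmap_on n) (T : {set 'I_n})
    (x y u v w : 'I_n) :
    a \in ORCP n -> convex T -> kernel_section a T ->
    papp a x = Some u -> papp a y = Some v -> u <= w <= v ->
  exists2 t, t \in T & papp a t = Some w.
Proof.
move=> aO cT kT xu yv uwv; have [domT _ surjT] := kT.
have [s sT su] := surjT x u xu; have [t tT tv] := surjT y v yv.
have iso s t u v := @section_isometry _ _ _ s t u v aO cT kT.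
have [st|/ltnW ts] := leqP s t.
  (* By the isometry, a preimage of [w] in [T] can only lie at distance [w - u] from [s], towards
     [t]. *)
  have zn : s + (w - u) < n.
    by have := iso s t u v sT tT su tv st; have := ltn_ord t; lia.
  have zT : Ordinal zn \in T.
    move/convexP: cT; apply; [exact: sT|exact: tT|].
    by have := iso s t u v sT tT su tv st; rewrite /=; lia.
  have [w' zw'] := domT _ zT; exists (Ordinal zn) => //.
  rewrite zw'; congr Some; apply: val_inj => /=.
  (* The distance to [s] leaves two candidates for [w']; the distance to [t] rules out the reflected
     one. *)
  have := iso _ _ _ _ sT zT su zw'; have := iso _ _ _ _ zT tT zw' tv.
  by have := iso _ _ _ _ sT tT su tv st; rewrite /=; lia.
have zn : s - (w - u) < n by have := ltn_ord s; lia.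
have zT : Ordinal zn \in T.
  move/convexP: cT; apply; [exact: tT|exact: sT|].
  by have := iso t s v u tT sT tv su ts; rewrite /=; lia.
have [w' zw'] := domT _ zT; exists (Ordinal zn) => //.
rewrite zw'; congr Some; apply: val_inj => /=.
have := iso _ _ _ _ zT sT zw' su; have := iso _ _ _ _ tT zT tv zw'.
by have := iso _ _ _ _ tT sT tv su ts; rewrite /=; lia.
Qed.

(** * The inverse on a convex transversal, and regularity *)

(** For a kernel section [T] the pick has at most one candidate, by injectivity of [a] on [T]. *)
Definition section_inverse (n : nat) (a : pmap_on n) (T : {set 'I_n}) :
    pmap_on n :=
  [ffun u => [pick t in T | papp a t == Some u]].

Lemma section_inverseP (n : nat) (a : pmap_on n) (T : {set 'I_n}) u t :
    kernel_section a T ->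
  papp (section_inverse a T) u = Some t <-> t \in T /\ papp a t = Some u.
Proof.
case=> _ injT _; rewrite /papp ffunE -!/(papp _ _).
case: pickP => [s /andP[sT /eqP su]|none]; last first.
  by split=> // -[tT tu]; have := none t; rewrite tT tu eqxx.
split=> [[<-] //|[tT tu]]; congr Some.
by apply: injT => //; rewrite su tu.
Qed.

(** The inverse of an isometry is an isometry, and it keeps the direction of [a]. *)
Lemma section_inverse_ORCP (n : nat) (a : pmap_on n) (T : {set 'I_n}) :
    a \in ORCP n -> convex T -> kernel_section a T ->
  section_inverse a T \in ORCP n.
Proof.
move=> aO cT kT; have invP u t := section_inverseP u t kT.
have iso s t u v := @section_isometry _ _ _ s t u v aO cT kT.
apply/ORCP_P; split.
  move=> u v s t /invP[sT su] /invP[tT tv] uv.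
  have := iso _ _ _ _ sT tT su tv; have := iso _ _ _ _ tT sT tv su; lia.
have /ORCP_P[_ [op|rev]] := aO; [left|right] => u v s t /invP[sT su] /invP[tT tv].
  have := iso _ _ _ _ tT sT tv su; have := op _ _ _ _ tv su; lia.
have := iso _ _ _ _ sT tT su tv; have := rev _ _ _ _ su tv; lia.
Qed.

Lemma pappM (n : nat) (a b : pmap_on n) x :
  papp (a * b)%g x = obind (papp b) (papp a x).
Proof. by rewrite /papp ffunE. Qed.

Lemma mul_section_inverse (n : nat) (a : pmap_on n) (T : {set 'I_n}) :
  kernel_section a T -> (a * section_inverse a T * a)%g = a.
Proof.
move=> kT; apply/ffunP => x; rewrite -!/(papp _ _) !pappM.
case xu : (papp a x) => [u|] //=.
have [t tT tu] : exists2 t, t \in T & papp a t = Some u.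
  by case: kT => _ _; apply; exact: xu.
by have /(section_inverseP u t kT) -> : t \in T /\ papp a t = Some u.
Qed.

(** Regularity comes from the transversal: [section_inverse a T] is an inner inverse of [a] in
    [ORCP n]. *)
Lemma SRegP (n : nat) (a : pmap_on n) :
  reflect (a \in ORCP n /\ exists2 T : {set 'I_n}, convex T & kernel_section a T)
          (a \in SReg n).
Proof.
rewrite [a \in SReg n]in_set; apply: (iffP andP).
  case=> /andP[aO _] /existsP[T /andP[/transversal_KerP kT cT]].
  by split=> //; exists T.
case=> aO [T cT kT]; split; last first.
  by apply/existsP; exists T; rewrite cT andbT; apply/transversal_KerP.
rewrite /regular_in aO; apply/exists_inP; exists (section_inverse a T).
  exact: section_inverse_ORCP.
by rewrite mul_section_inverse.
Qed.

(** The inverse is injective, so its domain is a transversal of its kernel; this domain is the image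
    of [a], which is convex. *)
Lemma section_inverse_SReg (n : nat) (a : pmap_on n) (T : {set 'I_n}) :
    a \in ORCP n -> convex T -> kernel_section a T ->
  section_inverse a T \in SReg n.
Proof.
move=> aO cT kT; have invP u t := section_inverseP u t kT.
apply/SRegP; split; first exact: section_inverse_ORCP.
exists (Dom (section_inverse a T)).
  apply/convexP => u v w /DomP[s /invP[_ su]] /DomP[t /invP[_ tv]] uwv.
  have [r rT rw] := section_image_convex aO cT kT su tv uwv.
  by apply/DomP; exists r; apply/invP.
split=> [u /DomP//|u v /DomP[s us] _|u t ut].
  rewrite us => /esym/invP[_ sv]; have /invP[_ su] := us.
  by move: su; rewrite sv => -[].
by exists u => //; apply/DomP; exists t.
Qed.

Lemma papp_mul_intro (n : nat) (a b : pmap_on n) x u w :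
  papp a x = Some u -> papp b u = Some w -> papp (a * b)%g x = Some w.
Proof. by rewrite pappM => ->. Qed.

(** * Convex transversals of products *)

Section Product.

Context {n : nat} {a b : pmap_on n} {T1 T2 : {set 'I_n}}.
Hypotheses (aO : a \in ORCP n) (bO : b \in ORCP n).
Hypotheses (cT1 : convex T1) (kT1 : kernel_section a T1).
Hypotheses (cT2 : convex T2) (kT2 : kernel_section b T2).

Lemma mul_section_meet (t0 u0 : 'I_n) :
    t0 \in T1 -> papp a t0 = Some u0 -> u0 \in T2 ->
  exists2 T : {set 'I_n}, convex T & kernel_section (a * b)%g T.
Proof.
move=> t0T tu0 u0T; have [dom1 inj1 surj1] := kT1; have [dom2 inj2 surj2] := kT2.
pose T := [set t in T1 | if papp a t is Some u then u \in T2 else false].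
have TP t : reflect (t \in T1 /\ exists2 u, papp a t = Some u & u \in T2) (t \in T).
  rewrite inE; apply: (iffP andP) => -[tT]; last by case=> u -> uT.
  by case: (papp a t) => // u uT; split=> //; exists u.
exists T.
  apply/convexP => x y z /TP[xT [u xu uT]] /TP[yT [v yv vT]] xzy.
  have zT : z \in T1 by apply: (convexP _ cT1) xzy.
  have [w zw] := dom1 z zT; apply/TP; split=> //; exists w => //.
  have /orP[uwv|vwu] := ORCP_between aO xu zw yv xzy.
    exact: (convexP _ cT2) uT vT uwv.
  exact: (convexP _ cT2) vT uT vwu.
split=> [t /TP[tT [u tu uT]]|s t /TP[sT [u su uT]] /TP[tT [v tv vT]]|x w].
- by have [w uw] := dom2 u uT; exists w; apply: papp_mul_intro tu uw.
- have [u' uu'] := dom2 u uT; have [v' vv'] := dom2 v vT.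
  rewrite (papp_mul_intro su uu') (papp_mul_intro tv vv') -uu' -vv' => uv.
  by apply: inj1; rewrite // su tv (inj2 u v).
- case/papp_mul=> u xu uw; have [v vT vw] := surj2 u w uw.
  have [w0 uw0] := dom2 u0 u0T.
  suff [t tT tv] : exists2 t, t \in T1 & papp a t = Some v.
    by exists t; [apply/TP; split=> //; exists v | apply: papp_mul_intro tv vw].
  have [uT|uT] := boolP (u \in T2).
    by rewrite -(inj2 u v) //; [apply: surj1 xu | rewrite uw vw].
  have out2 (p q : 'I_n) : p \in T2 -> q \in T2 -> p <= u <= q -> False.
    by move=> pT qT puq; rewrite (convexP _ cT2 p q) in uT.
  have nuv := out2 _ _ u0T vT; have nvu := out2 _ _ vT u0T.
  have nuu := out2 _ _ u0T u0T.
  (* [b] agrees at [u] and [v], so it has the same value at any point of its domain between them;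
     injectivity on [T2] then applies. *)
  have no_between : (u <= u0 <= v) || (v <= u0 <= u) -> u0 = v.
    move=> btw; apply: inj2 => //; rewrite vw uw0; congr Some; apply: val_inj.
    case/orP: btw => btw.
      by have := ORCP_between bO uw uw0 vw btw; rewrite /=; lia.
    by have := ORCP_between bO vw uw0 uw btw; rewrite /=; lia.
  have [<-|nv] := eqVneq u0 v; first by exists t0.
  (* As [u] is outside the convex [T2], [v] and [u0] lie on the same side of it, with [v] the
     nearer. So [v] is between two image points of [a]. *)
  have [uv|vu] : u <= v <= u0 \/ u0 <= v <= u.
  - have : ~ ((u <= u0 <= v) || (v <= u0 <= u)).
      by move/no_between => E; rewrite E eqxx in nv.
    by lia.
  - exact: section_image_convex aO cT1 kT1 xu tu0 uv.
  - exact: section_image_convex aO cT1 kT1 tu0 xu vu.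
Qed.

Lemma mul_constant (x y u v p q : 'I_n) :
    (forall t u, t \in T1 -> papp a t = Some u -> u \notin T2) ->
    papp a x = Some u -> papp a y = Some v ->
    papp b u = Some p -> papp b v = Some q -> u <= v ->
  p = q.
Proof.
move=> miss xu yv up vq uv; have [_ _ surj2] := kT2.
(* The image of [a] is convex and attained on [T1], so the whole interval from [u] to [v] avoids
   [T2]. *)
have out (w : 'I_n) : u <= w <= v -> w \notin T2.
  by case/(section_image_convex aO cT1 kT1 xu yv) => t tT /miss; apply.
have [s sT sp] := surj2 u p up; have [t tT tq] := surj2 v q vq.
have ns : ~ (u <= s <= v) by move/out; rewrite sT.
have nt : ~ (u <= t <= v) by move/out; rewrite tT.
have u_out : u \notin T2 by apply: out; rewrite leqnn.
have nst : ~ (s <= u <= t).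
  by move=> sut; rewrite (convexP _ cT2 s t) in u_out.
have nts : ~ (t <= u <= s).
  by move=> tus; rewrite (convexP _ cT2 t s) in u_out.
apply: val_inj => /=.
(* Now [s] and [t] are on one side of the interval. Above it, [v] is squeezed between [u] and [s],
   both sent to [p]; below it, [u] is squeezed between [t] and [v], both sent to [q]. *)
have [vs|su] : v <= s \/ s <= u by lia.
  have vt : v <= t by lia.
  have := ORCP_between bO up vq sp; have := ORCP_between bO up vq tq; lia.
have tu : t <= u by lia.
have := ORCP_between bO sp up vq; have := ORCP_between bO tq up vq; lia.
Qed.

(** A constant nonempty product has a single fibre, so any one point of its domain is a convex
    transversal; for the empty product the empty set serves. *)
Lemma mul_section_miss :
    (forall t u, t \in T1 -> papp a t = Some u -> u \notin T2) ->
  exists2 T : {set 'I_n}, convex T & kernel_section (a * b)%g T.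
Proof.
move=> miss; have [/set0Pn[x /DomP[w xw]]|] := boolP (Dom (a * b)%g != set0).
  exists [set x].
    by apply/convexP => y z t /set1P-> /set1P-> xtx; apply/set1P/val_inj => /=; lia.
  split=> [t /set1P->|s t /set1P-> /set1P->|y w' yw'] //; first by exists w.
  exists x; first exact: set11.
  have [u xu uw] := papp_mul xw; have [v yv vw'] := papp_mul yw'; rewrite xw.
  have [uv|/ltnW vu] := leqP u v; first by rewrite (mul_constant miss xu yv uw vw').
  by rewrite (mul_constant miss yv xu vw' uw).
move=> /negPn/eqP D0; exists set0.
  by apply/convexP => x y z; rewrite inE.
split=> [t|s t|x w xw]; rewrite ?inE //.
by have /DomP : exists w, papp (a * b)%g x = Some w by [exists w]; rewrite D0 inE.
Qed.

End Product.

(** * Closure under composition and the theorem *)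

Lemma SReg_mulg_closed (n : nat) : mulg_closed (SReg n).
Proof.
move=> a b /SRegP[aO [T1 cT1 kT1]] /SRegP[bO [T2 cT2 kT2]].
apply/SRegP; split; first exact: ORCP_mulg_closed.
have [/exists_inP[t tT /existsP[u /andP[/eqP tu uT]]]|none] :=
  boolP [exists t in T1, exists u, (papp a t == Some u) && (u \in T2)].
  exact: (mul_section_meet aO bO cT1 kT1 cT2 kT2 tT tu uT).
apply: (mul_section_miss aO bO cT1 kT1 cT2 kT2) => t u tT tu.
apply: contra none => uT; apply/exists_inP; exists t => //.
by apply/existsP; exists u; rewrite tu eqxx.
Qed.

Unset Implicit Arguments.

Theorem theorem3p5 (n : nat) (n_ge1 : 1 <= n) :
  subsemigroup (SReg n) (ORCP n) /\ regular_semigroup (SReg n).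
Proof.
split; split; try exact: SReg_mulg_closed.
  by apply/subsetP => a /SRegP[].
move=> a aS; have /SRegP[aO [T cT kT]] := aS.
(* Regularity is asked inside [SReg n], so the inner inverse must itself be strongly regular. *)
rewrite /regular_in aS; apply/exists_inP; exists (section_inverse a T).
  exact: section_inverse_SReg.
by rewrite mul_section_inverse.
Qed.
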